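(* Let $\Gamma=\mathrm{Cay}(\mathbb{Z}_n,S)$ be a connected $|S|$-regular graph, where $|S|$ is even. Then $\Gamma$ contains no $(|S|,0)$-regular set.
   Context: $\mathbb{Z}_n$ denotes the cyclic group of order $n$, written multiplicatively, with identity $e$, and $S\subseteq\mathbb{Z}_n\setminus\{e\}$ is inverse-closed. The Cayley graph $\mathrm{Cay}(\mathbb{Z}_n,S)$ is the simple graph with vertex set $\mathbb{Z}_n$ in which $y$ and $z$ are adjacent if and only if $y^{-1}z\in S$. For a graph $\Gamma$ and nonnegative integers $a,b$, a nonempty proper subset $C$ of $V(\Gamma)$ is an $(a,b)$-regular set of $\Gamma$ if every vertex in $C$ has exactly $a$ neighbours in $C$ and every vertex in $V(\Gamma)\setminus C$ has exactly $b$ neighbours in $C$. *)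

(* Defs.v *)
From mathcomp Require Import all_boot all_fingroup all_solvable.

Set Implicit Arguments.
Unset Strict Implicit.
Unset Printing Implicit Defensive.

Local Open Scope group_scope.

(* A simple graph is an adjacency relation on a finite vertex type that is
   symmetric and irreflexive; see cayley_sym and cayley_irr for the graphs
   considered here. *)
Section Graphs.
Variables (V : finType) (e : rel V).

Definition neighbours (x : V) : {set V} := [set y | e x y].

Definition regular_graph (k : nat) : Prop := forall x : V, #|neighbours x| = k.

Definition connected_graph : Prop := forall x y : V, connect e x y.

Definition regular_set (a b : nat) (C : {set V}) : Prop :=
  [/\ C != set0, C \proper [set: V],
      forall x, x \in C -> #|neighbours x :&: C| = a
    & forall x, x \notin C -> #|neighbours x :&: C| = b].

End Graphs.

Section Cayley.
Variable gT : finGroupType.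

Definition inverse_closed (S : {set gT}) : Prop :=
  forall x, x \in S -> x^-1 \in S.

Definition cayley (S : {set gT}) : rel gT := fun y z => y^-1 * z \in S.

Lemma cayley_sym (S : {set gT}) : inverse_closed S -> symmetric (cayley S).
Proof.
move=> SV y z; rewrite /cayley.
by apply/idP/idP => /SV; rewrite invMg invgK.
Qed.

Lemma cayley_irr (S : {set gT}) : 1 \notin S -> irreflexive (cayley S).
Proof. by move=> S1 y; rewrite /cayley mulVg; apply/negbTE. Qed.

End Cayley.

(* Main.v *)
Require Import Defs.
From mathcomp Require Import all_boot all_fingroup all_solvable.

(** In a [k]-regular graph, a [(k, 0)]-regular set [C] is a union of connected
    components: a vertex of [C] has all its [k] neighbours in [C], and a vertex
    outside [C] has none there, so no edge leaves or enters [C]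
    ([regular_set_closed]).  A connected graph has a single component, so [C],
    being nonempty, is the whole vertex set, whereas regular sets are proper
    ([connected_no_regular_set]).  The theorem is this fact for a Cayley
    graph. *)

Lemma regular_set_closed (V : finType) (e : rel V) (k : nat) (C : {set V}) :
  regular_graph e k -> regular_set e k 0 C -> closed e C.
Proof.
move=> e_reg [_ _ C_in C_out] x y exy.
have [xC | xNC] := boolP (x \in C).
  (* the intersection has as many elements as the whole neighbourhood *)
  have /eqP/setIidPl/subsetP-> // : neighbours e x :&: C == neighbours e x.
    by rewrite eqEcard subsetIl C_in // e_reg leqnn.
  by rewrite inE.
have /setP/(_ y) := cards0_eq (C_out x xNC).
by rewrite !inE exy.
Qed.

Lemma connected_no_regular_set (V : finType) (e : rel V) (k : nat)
  (C : {set V}) :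
  connected_graph e -> regular_graph e k -> ~ regular_set e k 0 C.
Proof.
move=> e_conn e_reg C_reg.
have C_closed := regular_set_closed V e k C e_reg C_reg.
case: C_reg => /set0Pn[x xC] /properP[_ [y _ /negP yNC]] _ _.
by apply: yNC; rewrite -(closed_connect C_closed (e_conn x y)).
Qed.

Theorem theorem5p4 (n : nat) (gT : finGroupType) (S : {set gT})
  (gT_cyclic : cyclic [set: gT]) (gT_order : #|[set: gT]| = n)
  (S_non1 : (1%g : gT) \notin S) (S_inv : inverse_closed S)
  (Gamma_connected : connected_graph (cayley S))
  (Gamma_regular : regular_graph (cayley S) #|S|)
  (S_even : ~~ odd #|S|) :
  ~ exists C : {set gT}, regular_set (cayley S) #|S| 0 C.
Proof.
by case=> C; exact: (connected_no_regular_set _ _ _ C Gamma_connected Gamma_regular).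
Qed.
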